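(* Fix $K\ge3$, $\theta>0$, $p>0$ and, for $N\ge2$, let $\nu_N$ be the stationary distribution of the $N$-particle process on $\mathcal{E}_{K,N}$ with generator $\mathcal{L}_{K,N}$. Let $\nu_{\mathrm{qs}}$ be the uniform distribution on $\mathbb{Z}/K\mathbb{Z}$. Then, as $N\to\infty$, \[ \mathbb{E}_{\nu_N}\big[\|m(\eta)-\nu_{\mathrm{qs}}\|_2\big]\le\sqrt{\frac{K-1}{N}}\,\sqrt{1+\frac{p(K+1)}{6(1+\theta)}}+o\left(\frac1{\sqrt N}\right). \]
   Context: $\mathcal{E}_{K,N}=\{\eta:\mathbb{Z}/K\mathbb{Z}\to\mathbb{N},\ \sum_{k}\eta(k)=N\}$ ($\mathbb{N}$ includes $0$). The generator is \[ (\mathcal{L}_{K,N}f)(\eta)=\sum_{i,j\in\mathbb{Z}/K\mathbb{Z}}\eta(i)\left(\mathbf{1}_{\{j=i+1\}}+\theta\,\mathbf{1}_{\{j=i-1\}}+p\frac{\eta(j)}{N-1}\right)[f(T_{i\to j}\eta)-f(\eta)], \] with $T_{i\to j}\eta=\eta-\mathbf{e}_i+\mathbf{e}_j$ (when $\eta(i)>0$). The process is irreducible and $\nu_N$ is its unique stationary distribution; $\mathbb{E}_{\nu_N}$ is expectation when $\eta$ has law $\nu_N$. The empirical distribution of $\eta\in\mathcal{E}_{K,N}$ is $m(\eta)=\frac1N\sum_{k=0}^{K-1}\eta(k)\delta_{\{k\}}$, and $\|\mu\|_2=(\sum_x|\mu(x)|^2)^{1/2}$ for a signed measure $\mu$ on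 $\mathbb{Z}/K\mathbb{Z}$. (The uniform distribution is the quasi-stationary distribution of a single particle jumping $x\to x+1$ at rate $1$, $x\to x-1$ at rate $\theta$ and killed at rate $p$.) *)

(* Defs.v *)
From HB Require Import structures.
From mathcomp Require Import all_boot all_order all_algebra.
From mathcomp Require Import all_classical all_reals all_analysis.

Set Implicit Arguments.
Unset Strict Implicit.
Unset Printing Implicit Defensive.

Import Order.TTheory GRing.Theory Num.Theory.
Import numFieldNormedType.Exports.

Local Open Scope ring_scope.

(* 'Z_K is Z/KZ only for 1 < K.  Occupation numbers summing to N are at most N,
   so taking them in 'I_N.+1 loses nothing and makes the state space a
   finType. *)
Record config (K N : nat) := Config {
  occ :> {ffun 'Z_K -> 'I_N.+1};
  _ : (\sum_(k : 'Z_K) nat_of_ord (occ k) == N)%N }.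

#[hnf] HB.instance Definition _ K N := [isSub for @occ K N].
#[hnf] HB.instance Definition _ K N := [Finite of config K N by <:].

(* eta - e_i + e_j when eta i > 0 (see move_toE); otherwise the value is
   irrelevant, since such a jump has rate 0 in the generator. *)
Definition move_to K N (i j : 'Z_K) (eta : config K N) : config K N :=
  insubd eta [ffun k => inord (eta k - (k == i) + (k == j))%N].

Lemma move_toE K N (i j k : 'Z_K) (eta : config K N) :
  (0 < eta i)%N -> move_to i j eta k = (eta k - (k == i) + (k == j))%N :> nat.
Proof.
move=> ei.
have single (l : 'Z_K) : (\sum_(k : 'Z_K) (k == l) = 1)%N.
  by rewrite (bigD1 l) //= eqxx big1 // => m /negbTE ->.
have le_ei m : ((m == i) <= eta m)%N by case: eqP => // ->.
have tot : (\sum_(m : 'Z_K) (eta m - (m == i) + (m == j)) = N)%N.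
  have /eqP eN := valP eta.
  rewrite big_split /= single sumnB // single.
  by rewrite [X in (X - 1)%N]eN subnK // -eN (bigD1 i) //= addn_gt0 ei.
have bd m : (eta m - (m == i) + (m == j) < N.+1)%N.
  rewrite ltnS; apply: leq_trans (eq_leq tot).
  by rewrite [X in (_ <= X)%N](bigD1 m) //= leq_addr.
rewrite /move_to -[occ _]/(val _) insubdK; first by rewrite ffunE inordK.
by apply/eqP; apply: etrans tot; apply: eq_bigr => m _; rewrite ffunE inordK.
Qed.

Definition fv_generator (R : realType) (K : nat) (theta p : R) (N : nat)
    (f : config K N -> R) (eta : config K N) : R :=
  \sum_(i : 'Z_K) \sum_(j : 'Z_K)
    (eta i)%:R *
    ((j == i + 1)%:R + theta * (j == i - 1)%:R
       + p * ((eta j)%:R / (N%:R - 1))) *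
    (f (move_to i j eta) - f eta).

Definition is_distribution (R : realType) (T : finType) (nu : T -> R) : Prop :=
  (forall x, 0 <= nu x) /\ \sum_(x : T) nu x = 1.

Definition mean (R : realType) (T : finType) (nu f : T -> R) : R :=
  \sum_(x : T) nu x * f x.

(* On a finite state space the law nu is stationary for the process with
   generator L iff nu L = 0, i.e. L f has nu-mean 0 for every f. *)
Definition is_stationary (R : realType) (K : nat) (theta p : R) (N : nat)
    (nu : config K N -> R) : Prop :=
  is_distribution nu /\
  forall f : config K N -> R, mean nu (fv_generator theta p f) = 0.

(* (Signed) measures on Z/KZ are represented by their point masses. *)
Definition dirac_mass (R : realType) (K : nat) (k : 'Z_K) : 'Z_K -> R :=
  fun x => (x == k)%:R.

Definition empirical (R : realType) (K N : nat) (eta : config K N) : 'Z_K -> R :=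
  fun x => N%:R^-1 * \sum_(k : 'Z_K) (eta k)%:R * dirac_mass R k x.

Definition uniform_mass (R : realType) (K : nat) : 'Z_K -> R := fun=> K%:R^-1.

Definition norm2 (R : realType) (K : nat) (mu : 'Z_K -> R) : R :=
  Num.sqrt (\sum_(x : 'Z_K) `|mu x| ^+ 2).

(* Main.v *)
Require Import Defs.
From HB Require Import structures.
From mathcomp Require Import all_boot all_order all_algebra.
From mathcomp Require Import all_classical all_reals all_analysis.
From mathcomp Require Import zify ring lra.

Set Implicit Arguments.
Unset Strict Implicit.
Unset Printing Implicit Defensive.

Import Order.TTheory GRing.Theory Num.Theory.
Import numFieldNormedType.Exports.

Local Open Scope classical_set_scope.
Local Open Scope ring_scope.

(** The mean distance is at most the square root of the mean squared distance,
    and the squared distance of the empirical measure to the uniform one is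
    [Q / N ^ 2 - 1 / K] with [Q eta = \sum_x eta x ^ 2]. So everything rests on
    bounding the stationary mean of [Q], an observable quadratic in [eta].

    Quadratic observables invariant under rotation of the cycle are the
    [\sum_(x, y) eta x * eta y * h (y - x)] with [h] even, and the generator
    maps this family, up to constants, into itself ([fv_generator_pair_form]).
    The jumps to neighbours turn [h] into its discrete Laplacian, the two
    directions contributing equally because [h] is even. The selection jumps,
    from [i] to [j] at a rate symmetric in [i] and [j], cancel at first order,
    and only leave the term created by the jumping particle itself, which is
    smaller by a factor of order [N].

    It remains to choose [h] so that the Laplacian isolates [Q]. This is, up to
    sign and normalization, the Green function of the cycle,
    [h d = d * (K - d) / 2], whose Laplacian is [K] times the point mass at [0]
    minus [1] ([laplacian_cycle_green]):
    stationarity applied to it expresses the mean of [Q] as its multinomial value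
    plus a positive multiple of the mean of the observable itself
    ([second_moment_le]). Since [h <= K ^ 2 / 8] and [h 0 = 0], that observable is
    at most [K ^ 2 / 8] times the number of ordered pairs of distinct particles.

    This gives the bound
    [(1 - 1 / K + p * K / (4 * (1 + theta))) / N] on the mean squared distance,
    for each [N >= 2]. For [K >= 3] it is below the square of the announced main
    term, so the remainder can be taken to be zero. *)

(** * Means over a finite state space *)

Lemma sum_indicator (R : pzRingType) (T : finType) (F : T -> R) (i : T) :
  \sum_x (x == i)%:R * F x = F i.
Proof.
rewrite (bigD1 i) //= eqxx mul1r big1 ?addr0 // => x /negbTE ->.
by rewrite mul0r.
Qed.

Lemma mean_le (R : realType) (T : finType) (nu f g : T -> R) :
  is_distribution nu -> (forall x, f x <= g x) -> mean nu f <= mean nu g.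
Proof. by move=> [nu0 _] fg; apply: ler_sum => x _; apply: ler_wpM2l. Qed.

Lemma mean_affine (R : realType) (T : finType) (nu f : T -> R) (a b : R) :
  is_distribution nu -> mean nu (fun x => a * f x + b) = a * mean nu f + b.
Proof.
move=> [_ nu1]; rewrite /mean mulr_sumr -[b in RHS]mulr1 -nu1 mulr_sumr.
by rewrite -big_split; apply: eq_bigr => x _ /=; ring.
Qed.

(** The gap between the two squares is the variance of [f], hence
    nonnegative. *)
Lemma mean_le_sqrt (R : realType) (T : finType) (nu f : T -> R) :
  is_distribution nu -> mean nu f <= Num.sqrt (mean nu (fun x => f x ^+ 2)).
Proof.
move=> [nu0 nu1]; move mE: (mean nu f) => m.
have var_ge0 : 0 <= \sum_x nu x * (f x - m) ^+ 2.
  by apply: sumr_ge0 => x _; rewrite mulr_ge0 ?sqr_ge0.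
have varE : \sum_x nu x * (f x - m) ^+ 2
    = mean nu (fun x => f x ^+ 2) - m ^+ 2.
  transitivity (mean nu (fun x => f x ^+ 2) - 2 * m * mean nu f
                + m ^+ 2 * \sum_x nu x).
    rewrite /mean !mulr_sumr -sumrB -big_split.
    by apply: eq_bigr => x _ /=; ring.
  by rewrite nu1 mE; ring.
apply: le_trans (ler_norm m) _; rewrite -sqrtr_sqr ler_wsqrtr //.
by rewrite -subr_ge0 -varE.
Qed.

(** * Translation-invariant quadratic observables on the cycle *)

Section PairForm.
Variables (R : realType) (K : nat).
Implicit Types (h a b : 'Z_K -> R) (i j d : 'Z_K).

Definition pair_form h a b : R := \sum_x \sum_y a x * b y * h (y - x).

Definition laplacian h d : R := h (d + 1) + h (d - 1) - 2 * h d.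

Lemma pair_formC h a b :
  (forall d, h (- d) = h d) -> pair_form h a b = pair_form h b a.
Proof.
move=> h_even; rewrite /pair_form exchange_big /=.
apply: eq_bigr => y _; apply: eq_bigr => x _.
by rewrite -h_even opprB [a x * _]mulrC.
Qed.

Lemma pair_form_delta h a j :
  pair_form h a (fun y => (y == j)%:R) = \sum_x a x * h (j - x).
Proof.
apply: eq_bigr => x _.
rewrite -(sum_indicator (fun y => a x * h (y - x))).
by apply: eq_bigr => y _; ring.
Qed.

(** With [b = a + delta], [delta] the difference of the point masses at [j] and
    [i], the first summand is the cross term of the expansion in [delta] and
    the second one is the form evaluated at [delta]. *)
Lemma pair_form_jump h a b i j :
    (forall d, h (- d) = h d) ->
    (forall k, b k = a k - (k == i)%:R + (k == j)%:R) ->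
  pair_form h b b - pair_form h a a =
    2 * (\sum_x a x * h (j - x) - \sum_x a x * h (i - x))
    + 2 * (h 0 - h (j - i)).
Proof.
move=> h_even bE; rewrite -!pair_form_delta.
set ei := fun y => (y == i)%:R; set ej := fun y => (y == j)%:R.
have eval l m : pair_form h (fun y => (y == l)%:R) (fun y => (y == m)%:R)
    = h (m - l) by rewrite pair_form_delta (sum_indicator (fun x => h (m - x))).
transitivity (pair_form h a ej - pair_form h a ei
    + (pair_form h ej a - pair_form h ei a)
    + (pair_form h ej ej + pair_form h ei ei
       - (pair_form h ei ej + pair_form h ej ei))).
  rewrite /pair_form; do !rewrite -?sumrB -?big_split /=.
  apply: eq_bigr => x _; do !rewrite -?sumrB -?big_split /=.
  by apply: eq_bigr => y _; rewrite !bE /ei /ej; ring.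
rewrite (pair_formC ej a) // (pair_formC ei a) // !eval !subrr.
by rewrite -[h (i - j)]h_even opprB; ring.
Qed.

(** Moving one unit from [i] to a neighbour shifts the argument of [h] by one
    step; as [h] is even, a clockwise and an anticlockwise step have the same
    total effect, whence the single factor [1 + theta]. The moves at rate
    [c * a i * a j] contribute nothing through the cross term, which is
    antisymmetric in [i] and [j]. *)
Lemma drift_pair_form h a (theta c : R) :
    (forall d, h (- d) = h d) ->
  \sum_i \sum_j a i * ((j == i + 1)%:R + theta * (j == i - 1)%:R + c * a j) *
     (2 * (\sum_x a x * h (j - x) - \sum_x a x * h (i - x))
      + 2 * (h 0 - h (j - i)))
  = (1 + theta) * (pair_form (laplacian h) a a - (\sum_i a i) * laplacian h 0)
    + 2 * c * ((\sum_i a i) ^+ 2 * h 0 - pair_form h a a).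
Proof.
move=> h_even.
(* P i is the potential at i created by the masses a under the kernel h. *)
pose P i := \sum_x a x * h (i - x).
pose S := \sum_i a i.
have formP : \sum_i a i * P i = pair_form h a a.
  rewrite /pair_form exchange_big /=; apply: eq_bigr => i _.
  by rewrite /P mulr_sumr; apply: eq_bigr => x _; ring.
have shiftP : \sum_i a i * P (i + 1) = \sum_i a i * P (i - 1).
  rewrite /P; under eq_bigr do rewrite mulr_sumr.
  rewrite exchange_big; apply: eq_bigr => i _.
  rewrite mulr_sumr; apply: eq_bigr => x _.
  by rewrite -[h (x + 1 - i)]h_even opprB addrAC opprD addrA; ring.
have lapP : \sum_i a i * P (i + 1) + \sum_i a i * P (i - 1) - 2 * \sum_i a i * P i
    = pair_form (laplacian h) a a.
  rewrite /pair_form exchange_big mulr_sumr -big_split -sumrB /=.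
  apply: eq_bigr => i _; rewrite /P !mulr_sumr -big_split -sumrB /=.
  apply: eq_bigr => x _; rewrite /laplacian [i + 1 - x]addrAC [i - 1 - x]addrAC.
  by ring.
transitivity (\sum_i a i * (2 * (P (i + 1) - P i) + 2 * (h 0 - h 1))
   + theta * \sum_i a i * (2 * (P (i - 1) - P i) + 2 * (h 0 - h (- 1)))
   + 2 * c * \sum_i \sum_j a i * a j * (P j - P i + (h 0 - h (j - i)))).
  rewrite !mulr_sumr -!big_split /=; apply: eq_bigr => i _.
  have -> : h 1 = h (i + 1 - i) by rewrite addrAC subrr add0r.
  have -> : h (- 1) = h (i - 1 - i) by rewrite addrAC subrr add0r.
  pose G j := a i * (2 * (P j - P i) + 2 * (h 0 - h (j - i))).
  rewrite -/(G (i + 1)) -/(G (i - 1)) -(sum_indicator G (i + 1)).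
  rewrite -(sum_indicator G (i - 1)) /G.
  rewrite !mulr_sumr -!big_split /=; apply: eq_bigr => j _.
  by rewrite -/(P i) -/(P j); ring.
(* The differences P j - P i cancel when i and j are exchanged. *)
have anti : \sum_i \sum_j a i * a j * (P j - P i + (h 0 - h (j - i)))
    = S ^+ 2 * h 0 - pair_form h a a.
  have -> : S ^+ 2 * h 0 = \sum_i \sum_j a i * a j * h 0.
    rewrite expr2 /S !mulr_suml; apply: eq_bigr => i _.
    by rewrite mulr_sumr mulr_suml.
  transitivity (\sum_i \sum_j a i * a j * P j - \sum_i \sum_j a i * a j * P i
     + (\sum_i \sum_j a i * a j * h 0 - pair_form h a a)).
    rewrite /pair_form -!sumrB -big_split; apply: eq_bigr => i _ /=.
    rewrite -!sumrB -big_split; apply: eq_bigr => j _ /=; ring.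
  rewrite [X in X - _]exchange_big /= -[RHS]add0r; congr (_ + _).
  rewrite -sumrB big1 // => i _; rewrite -sumrB big1 // => j _; ring.
have step (G : 'Z_K -> R) (u : R) :
    \sum_i a i * (2 * (G i - P i) + 2 * u)
    = 2 * (\sum_i a i * G i - \sum_i a i * P i) + 2 * u * S.
  rewrite /S -sumrB !mulr_sumr -big_split; apply: eq_bigr => i _ /=; ring.
rewrite anti (step (fun i => P (i + 1))) (step (fun i => P (i - 1))) -/S.
rewrite -lapP shiftP formP /laplacian !add0r h_even.
by ring.
Qed.

End PairForm.

Lemma sum_occ (R : pzSemiRingType) (K N : nat) (eta : config K N) :
  \sum_k (eta k)%:R = N%:R :> R.
Proof. by rewrite -natr_sum; have /eqP -> := valP eta. Qed.

(** The pair formed by a particle with itself is unaffected by its jumps, which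
    is why [N * laplacian h 0] is subtracted. *)
Lemma fv_generator_pair_form (R : realType) (K N : nat) (theta p : R)
    (h : 'Z_K -> R) (eta : config K N) :
    (forall d, h (- d) = h d) ->
  fv_generator theta p
    (fun xi : config K N =>
       pair_form h (fun k => (xi k)%:R) (fun k => (xi k)%:R)) eta
  = (1 + theta) * (pair_form (laplacian h) (fun k => (eta k)%:R)
                     (fun k => (eta k)%:R) - N%:R * laplacian h 0)
    + 2 * (p / (N%:R - 1))
      * (N%:R ^+ 2 * h 0
         - pair_form h (fun k => (eta k)%:R) (fun k => (eta k)%:R)).
Proof.
move=> h_even; set c := p / _; rewrite -(sum_occ R eta).
rewrite -drift_pair_form //; apply: eq_bigr => i _; apply: eq_bigr => j _.
(* From an empty site move_to takes no meaningful value, but the rate is 0. *)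
have [ei0 | ei_gt0] := posnP (eta i); first by rewrite ei0 !mul0r.
rewrite (pair_form_jump (i := i) (j := j) (a := fun k => (eta k)%:R)) //.
  by congr (_ * _ * _); rewrite /c; ring.
move=> k; rewrite move_toE // natrD natrB //.
by case: eqP => // ->.
Qed.

(** * The Green function of the cycle *)

(** [d] is read through its representative between [0] and [K - 1]. The value is
    half the expected time a simple symmetric walk on the cycle, making both of
    its moves at rate [1 / 2], takes to reach [0] from [d]. *)
Definition cycle_green (R : realType) (K : nat) (d : 'Z_K) : R :=
  d%:R * (K%:R - d%:R) / 2.

Lemma cycle_green_even (R : realType) (K : nat) (d : 'Z_K) :
  (1 < K)%N -> cycle_green R (- d) = cycle_green R d.
Proof.
case: K d => [|[|K]] // d _; rewrite /cycle_green /=.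
have [->|d0] := eqVneq (d : nat) 0%N; first by rewrite subn0 modnn.
have dK := ltn_ord d; rewrite /= in dK.
by rewrite modn_small; last lia; rewrite natrB; [ring | lia].
Qed.

(** The second difference of [d * (K - d) / 2] is [- 1]; at [0], whose neighbours
    are [1] and [K - 1], it is [K - 1]. *)
Lemma laplacian_cycle_green (R : realType) (K : nat) (d : 'Z_K) :
  (1 < K)%N -> laplacian (@cycle_green R K) d = K%:R * (d == 0)%:R - 1.
Proof.
case: K d => [|[|K]] // d _.
have dK : (d < K.+2)%N := ltn_ord d.
have succE : cycle_green R (d + 1) = (d%:R + 1) * (K.+2%:R - (d%:R + 1)) / 2.
  rewrite /cycle_green /= modnDmr addn1.
  have [dlt|dge] := ltnP d.+1 K.+2; first by rewrite modn_small // -natr1.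
  have -> : d.+1 = K.+2 by lia.
  have -> : d%:R + 1 = K.+2%:R :> R by rewrite natr1; congr _%:R; lia.
  by rewrite modnn; ring.
have pred_nat : nat_of_ord (d - 1) = (if d == 0%R then K.+1 else d.-1)%N.
  rewrite /= [(1 %% _)%N]modn_small // subn1 /= [(K.+1 %% _)%N]modn_small //.
  have [-> | /eqP d0] := eqVneq d 0; first by rewrite add0n modn_small.
  have dn0 : (d : nat) <> 0%N by move=> e; apply: d0; apply: val_inj.
  have -> : (d + K.+1 = d.-1 + K.+2)%N by lia.
  by rewrite modnDr modn_small //; lia.
rewrite /laplacian succE /cycle_green pred_nat.
have [-> | /eqP d0] := eqVneq d 0.
  by rewrite /= -[K.+2%:R]natr1; field.
have dn0 : (0 < d)%N by rewrite lt0n; apply/eqP => e; apply: d0; apply: val_inj.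
have -> : d%:R = d.-1%:R + 1 :> R by rewrite natr1 prednK.
by rewrite /=; field.
Qed.

(** [d * (K - d) <= K ^ 2 / 4]; a bound that vanishes at [0] makes the
    corresponding form count pairs of particles at distinct sites only. *)
Lemma cycle_green_le (R : realType) (K : nat) (d : 'Z_K) :
  cycle_green R d <= K%:R ^+ 2 / 8 * (1 - (d == 0)%:R).
Proof.
rewrite /cycle_green; have [->|_] := eqVneq d 0.
  by rewrite subrr mulr0 /= !mul0r.
rewrite subr0 mulr1.
have := sqr_ge0 (K%:R - 2 * d%:R : R); lra.
Qed.

(** * Stationary second moment *)

Lemma pair_form_diag (R : realType) (K : nat) (a : 'Z_K -> R) (u v : R) :
  pair_form (fun d => u * (d == 0)%:R + v) a a
  = u * (\sum_x a x ^+ 2) + v * (\sum_x a x) ^+ 2.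
Proof.
rewrite expr2 mulr_sumr mulr_suml mulr_sumr -big_split.
apply: eq_bigr => x _ /=.
rewrite mulr_sumr mulr_sumr -(sum_indicator (fun y => u * (a x * a y)) x).
rewrite -big_split; apply: eq_bigr => y _ /=; rewrite subr_eq0; ring.
Qed.

(** Pointwise lower bound on the generator applied to the observable of kernel
    [cycle_green], then stationarity, which makes the mean of the generator
    zero. The factor [N - 1] in the number of ordered pairs of particles cancels
    the one in the selection rate. *)
Lemma second_moment_le (R : realType) (K N : nat) (theta p : R)
    (nu : config K N -> R) :
    (1 < K)%N -> (1 < N)%N -> 0 < theta -> 0 < p ->
    is_stationary theta p nu ->
  K%:R * mean nu (fun eta => \sum_x (eta x)%:R ^+ 2)
  <= N%:R ^+ 2 + N%:R * (K%:R - 1) + p * K%:R ^+ 2 * N%:R / (4 * (1 + theta)).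
Proof.
move=> K1 N1 theta0 p0 [nuD nuL].
have N1' : 0 < N%:R - 1 :> R by rewrite subr_gt0 ltr1n.
set Q := fun eta : config K N => \sum_x (eta x)%:R ^+ 2.
have lower (eta : config K N) :
    K%:R * Q eta - N%:R ^+ 2 - N%:R * (K%:R - 1)
      - p * K%:R ^+ 2 * N%:R / (4 * (1 + theta))
    <= (1 + theta)^-1 * fv_generator theta p
        (fun xi : config K N => pair_form (@cycle_green R K)
           (fun k => (xi k)%:R) (fun k => (xi k)%:R)) eta.
  rewrite fv_generator_pair_form; last by move=> d; exact: cycle_green_even.
  have -> : pair_form (laplacian (@cycle_green R K)) (fun k => (eta k)%:R)
      (fun k => (eta k)%:R) = K%:R * Q eta - N%:R ^+ 2.
    rewrite -(sum_occ R eta) -mulN1r -pair_form_diag.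
    apply: eq_bigr => x _; apply: eq_bigr => y _.
    by rewrite laplacian_cycle_green.
  rewrite laplacian_cycle_green // eqxx mulr1.
  set F := pair_form _ _ _.
  have F_le : F <= K%:R ^+ 2 / 8 * (N%:R * (N%:R - 1)).
    apply: (@le_trans _ _ (K%:R ^+ 2 / 8 * (N%:R ^+ 2 - Q eta))).
      apply: le_trans (_ : pair_form (fun d => - (K%:R ^+ 2 / 8) * (d == 0)%:R
          + K%:R ^+ 2 / 8) (fun k => (eta k)%:R) (fun k => (eta k)%:R) <= _).
        apply: ler_sum => x _; apply: ler_sum => y _.
        rewrite ler_wpM2l ?mulr_ge0 //.
        by apply: le_trans (cycle_green_le _ _) _; lra.
      by rewrite pair_form_diag sum_occ -/(Q eta); lra.
    (* n <= n ^ 2 for the natural number n = eta x. *)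
    have : N%:R <= Q eta.
      rewrite -(sum_occ R eta); apply: ler_sum => x _; rewrite -natrX ler_nat.
      by case: (nat_of_ord _) => // n; rewrite leq_pmulr.
    by move=> NQ; rewrite ler_wpM2l //; lra.
  have -> : @cycle_green R K 0 = 0 by rewrite /cycle_green /= !mul0r.
  have split_rate A B : (1 + theta)^-1 * ((1 + theta) * A + B * (0 - F))
      = A - (1 + theta)^-1 * (B * F) by field; lra.
  rewrite mulr0 split_rate.
  have : (1 + theta)^-1 * (2 * (p / (N%:R - 1)) * F)
      <= p * K%:R ^+ 2 * N%:R / (4 * (1 + theta)).
    apply: le_trans (_ : (1 + theta)^-1 * (2 * (p / (N%:R - 1)) *
       (K%:R ^+ 2 / 8 * (N%:R * (N%:R - 1)))) <= _).
      by rewrite !ler_wpM2l // ?mulr_ge0 ?invr_ge0 //; lra.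
    rewrite le_eqVlt; apply/orP; left; apply/eqP; field.
    by apply/andP; split; lra.
  lra.
have := mean_le nuD lower.
(* Adding 0 puts the right-hand mean in the shape a * f x + b. *)
under [in X in _ <= X -> _]eq_fun do rewrite -[_ * _]addr0.
rewrite mean_affine // nuL mulr0 addr0.
under eq_fun do rewrite -!addrA.
rewrite mean_affine //; lra.
Qed.

(** * Distance to the uniform distribution *)

Lemma norm2_deviation (R : realType) (K N : nat) (eta : config K N) :
    (1 < K)%N -> (0 < N)%N ->
  norm2 (fun x => empirical R eta x - uniform_mass R x) ^+ 2
  = N%:R ^- 2 * (\sum_x (eta x)%:R ^+ 2) - K%:R^-1.
Proof.
move=> K1 N0; rewrite /norm2 sqr_sqrtr; last first.
  by apply: sumr_ge0 => x _; rewrite exprn_ge0.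
have K0 : K%:R != 0 :> R by rewrite pnatr_eq0; lia.
have N0' : N%:R != 0 :> R by rewrite pnatr_eq0; lia.
have cardE : \sum_(x : 'Z_K) 1 = K%:R :> R.
  by rewrite sumr_const card_ord Zp_cast.
transitivity (N%:R ^- 2 * (\sum_x (eta x)%:R ^+ 2)
    - 2 * N%:R^-1 * K%:R^-1 * (\sum_k (eta k)%:R)
    + K%:R ^- 2 * \sum_(x : 'Z_K) 1 : R); last first.
  by rewrite sum_occ cardE; field; apply/andP.
rewrite !mulr_sumr -sumrB -big_split; apply: eq_bigr => x _ /=.
rewrite real_normK ?num_real // /empirical /uniform_mass.
have -> : \sum_k (eta k)%:R * dirac_mass R k x = (eta x)%:R.
  rewrite -(sum_indicator (fun k => (eta k)%:R) x); apply: eq_bigr => k _.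
  by rewrite /dirac_mass eq_sym mulrC.
by field; apply/andP.
Qed.

(** The part [(1 - 1 / K) / N] is the mean squared distance for the empirical
    measure of [N] independent uniform points; the rest is the effect of the
    correlations created by selection. *)
Lemma mean_sqr_norm2_le (R : realType) (K N : nat) (theta p : R)
    (nu : config K N -> R) :
    (1 < K)%N -> (1 < N)%N -> 0 < theta -> 0 < p ->
    is_stationary theta p nu ->
  mean nu (fun eta => norm2 (fun x => empirical R eta x - uniform_mass R x) ^+ 2)
  <= (1 - K%:R^-1 + p * K%:R / (4 * (1 + theta))) / N%:R.
Proof.
move=> K1 N1 theta0 p0 nuS.
have K0 : 0 < K%:R :> R by rewrite ltr0n; lia.
have N_gt0 : (0 < N)%N by lia.
have N0 : 0 < N%:R :> R by rewrite ltr0n.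
have := second_moment_le K1 N1 theta0 p0 nuS.
under [in X in _ -> X]eq_fun do rewrite norm2_deviation //.
rewrite mean_affine; last by case: nuS.
set q := mean nu _ => q_le.
rewrite -(ler_pM2l (_ : 0 < K%:R * N%:R ^+ 2)); last by rewrite mulr_gt0 ?exprn_gt0.
have -> : K%:R * N%:R ^+ 2 * (N%:R ^- 2 * q - K%:R^-1) = K%:R * q - N%:R ^+ 2.
  by field; rewrite !gt_eqF.
have -> : K%:R * N%:R ^+ 2 * ((1 - K%:R^-1 + p * K%:R / (4 * (1 + theta))) / N%:R)
  = N%:R * (K%:R - 1) + p * K%:R ^+ 2 * N%:R / (4 * (1 + theta)).
  by field; rewrite !gt_eqF //=; lra.
lra.
Qed.

Theorem corollary1p7 (R : realType) (K : nat) (theta p : R)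
    (nu : forall N : nat, config K N -> R)
    (hK : (3 <= K)%N) (htheta : 0 < theta) (hp : 0 < p)
    (hnu : forall N : nat, (2 <= N)%N -> is_stationary theta p (nu N)) :
  exists r : nat -> R,
    r =o_\oo (fun N : nat => 1 / Num.sqrt (N%:R : R)) /\
    forall N : nat, (2 <= N)%N ->
      mean (nu N)
        (fun eta => norm2 (fun x => empirical R eta x - uniform_mass R x))
      <= Num.sqrt ((K%:R - 1) / N%:R)
           * Num.sqrt (1 + p * (K%:R + 1) / (6 * (1 + theta)))
         + r N.
Proof.
exists (fun=> 0); split.
  by apply/eqoP => e e0; apply: nearW => N; rewrite normr0 mulr_ge0 // ltW.
move=> N N2; rewrite addr0.
have K3 : 3 <= K%:R :> R by rewrite ler_nat.
have N0 : 0 < N%:R :> R by rewrite ltr0n; lia.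
have nuS := hnu N N2; have [nuD _] := nuS.
apply: le_trans (mean_le_sqrt _ nuD) _.
rewrite -sqrtrM; last by rewrite divr_ge0 //; lra.
apply: ler_wsqrtr.
apply: le_trans (mean_sqr_norm2_le _ N2 htheta hp nuS) _; first lia.
rewrite [leRHS]mulrAC ler_wpM2r ?invr_ge0 ?(ltW N0) //.
set t := p / (1 + theta).
have t0 : 0 < t by rewrite divr_gt0 //; lra.
have -> : p * K%:R / (4 * (1 + theta)) = t * (K%:R / 4).
  by rewrite /t; field; lra.
have -> : p * (K%:R + 1) / (6 * (1 + theta)) = t * ((K%:R + 1) / 6).
  by rewrite /t; field; lra.
have Kinv : 0 <= K%:R^-1 :> R by rewrite invr_ge0.
(* This is t / 12 times the inequality 3 * K <= 2 * (K ^ 2 - 1). *)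
have : t * (K%:R / 4) <= t * ((K%:R - 1) * ((K%:R + 1) / 6)).
  by rewrite ler_pM2l //; nra.
lra.
Qed.
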